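(* Let $\Delta$ be a proper geometric simplicial complex in $\mathbb{R}^d$, let $\omega$ be a linear differential, and let $k\ge 0$ be an integer. Assume that $(\Delta,\omega)$ is toric $k$-chordal and that $\Delta$ has no missing faces of dimension $k+1$. Then $(\Delta,\omega)$ is toric $(k+1)$-chordal.
   Context: A geometric simplicial complex in $\mathbb{R}^d$ is a finite abstract simplicial complex $\Delta$ with vertex set $\Delta^{(0)}$ together with a map $v\mapsto p_v\in\mathbb{R}^d$ on vertices (not necessarily inducing an embedding of the complex). It is proper if for every $j<d$ the image of the vertex set of every $j$-dimensional face linearly spans a subspace of dimension $j+1$. Let $\widetilde S(\Delta)\subset\mathbb{R}[x_v: v\in\Delta^{(0)}]$ be the linear span of all monomials whose support is a face of $\Delta$. The stress space is $S(\Delta)=\{q\in\widetilde S(\Delta):\sum_{v}\frac{\partial q}{\partial x_v}\,p_v=0\}$, and $S_k(\Delta)$ is its homogeneous part of degree $k$ (zero if $k<0$). A linear differential is an operator $\omega=\sum_v a_v\frac{\partial}{\partial x_v}$ with $a_v\in\mathbb{R}$. $(\Delta,\omega)$ is toric $k$-chordal if $\omega:S_{k+1}(\Delta)\to S_k(\Delta)$ is surjective and $\omega:S_k(\Delta)\to S_{k-1}(\Delta)$ is injective. A missing face of $\Delta$ is an inclusion-minimal subset $\sigma\subset\Delta^{(0)}$ that is not a face of $\Delta$; its dimension is $\#\sigma-1$. *)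

(* Defs.v *)
From HB Require Import structures.
From mathcomp Require Import all_boot all_order all_algebra.
From mathcomp Require Import classical_sets functions reals.
From mathcomp Require Import mpoly.

Set Implicit Arguments.
Unset Strict Implicit.
Unset Printing Implicit Defensive.

Import Order.TTheory GRing.Theory Num.Theory.
Local Open Scope ring_scope.

(* [V] is exactly the vertex set: every singleton is a face.  The empty set is
   then a face as soon as [V] is nonempty; for empty [V] both the void complex
   and the complex {empty set} are allowed. *)
Record simplicial_complex (V : finType) := SimplicialComplex {
  faces : {set {set V}};
  faces_down : forall s t : {set V}, t \subset s -> s \in faces -> t \in faces;
  faces_vertex : forall v : V, [set v]%SET \in faces
}.

Definition simplex_dim (V : finType) (s : {set V}) : int := #|s|%:Z - 1.

Definition missing_face (V : finType) (Delta : simplicial_complex V)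
    (s : {set V}) : bool :=
  minset (fun t : {set V} => t \notin faces Delta) s.

(* A geometric simplicial complex in R^d is a complex [Delta] together with an
   arbitrary map [p : V -> 'rV[R]_d]. *)
Definition proper_complex (R : realType) (V : finType) (d : nat)
    (Delta : simplicial_complex V) (p : V -> 'rV[R]_d) : Prop :=
  forall (j : nat) (s : {set V}), (j < d)%N ->
    s \in faces Delta -> simplex_dim s = j%:Z ->
    \dim <<[seq p v | v in s]>>%VS = j.+1.

(* The variables of [{mpoly R[#|V|]}] are indexed by ['I_#|V|]; the variable
   x_v attached to [v : V] is ['X_(enum_rank v)]. *)
Definition mnm_support (V : finType) (m : 'X_{1..#|V|}) : {set V} :=
  [set v : V | m (enum_rank v) != 0%N]%SET.

Definition dvar (R : realType) (V : finType) (v : V) (q : {mpoly R[#|V|]}) :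
  {mpoly R[#|V|]} := q^`M(enum_rank v).

Definition lindiff (R : realType) (V : finType) (a : V -> R)
    (q : {mpoly R[#|V|]}) : {mpoly R[#|V|]} :=
  \sum_(v : V) a v *: dvar v q.

Definition face_span (R : realType) (V : finType)
    (Delta : simplicial_complex V) : set {mpoly R[#|V|]} :=
  [set q | exists (ms : seq 'X_{1..#|V|}) (c : 'X_{1..#|V|} -> R),
     (forall m, m \in ms -> mnm_support m \in faces Delta) /\
     q = \sum_(m <- ms) c m *: 'X_[m]]%classic.

(* The relation sum_v (dq/dx_v) p_v = 0 is stated in R[x]^d, the coordinates of
   [p v] being viewed as constant polynomials. *)
Definition stress (R : realType) (V : finType) (d : nat)
    (Delta : simplicial_complex V) (p : V -> 'rV[R]_d) :
    set {mpoly R[#|V|]} :=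
  [set q | face_span Delta q /\
     \sum_(v : V) dvar v q *: map_mx (@mpolyC #|V| R) (p v) = 0]%classic.

(* [n.-homog] contains the zero polynomial for every [n]. *)
Definition stress_deg (R : realType) (V : finType) (d : nat)
    (Delta : simplicial_complex V) (p : V -> 'rV[R]_d) (k : int) :
    set {mpoly R[#|V|]} :=
  match k with
  | Posz n => [set q | stress Delta p q /\ q \is n.-homog]%classic
  | Negz _ => [set 0]%classic
  end.

(* [set_surj] and [set_inj] do not include that the map sends the source into
   the target; this is [lindiff_stress_deg] below. *)
Definition toric_chordal (R : realType) (V : finType) (d : nat)
    (Delta : simplicial_complex V) (p : V -> 'rV[R]_d) (a : V -> R)
    (k : int) : Prop :=
  set_surj (stress_deg Delta p (k + 1)) (stress_deg Delta p k) (lindiff a) /\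
  set_inj (stress_deg Delta p k) (lindiff a).

Lemma face_spanP (R : realType) (V : finType) (Delta : simplicial_complex V)
    (q : {mpoly R[#|V|]}) :
  face_span Delta q <->
  (forall m, m \in msupp q -> mnm_support m \in faces Delta).
Proof.
split=> [[ms [c [Hms ->]]] m | Hq].
  rewrite mcoeff_msupp raddf_sum /= => Hm; apply: Hms.
  apply: contraNT Hm => Hm; apply/eqP/big1_seq => m' /= m'ms.
  rewrite mcoeffZ mcoeffX; case: eqVneq => [E|_]; last by rewrite mulr0.
  by rewrite -E m'ms in Hm.
by exists (msupp q), (fun m => q@_m); split=> //; exact: mpolyE.
Qed.

Lemma dvar_face_span (R : realType) (V : finType)
    (Delta : simplicial_complex V) (v : V) (q : {mpoly R[#|V|]}) :
  face_span Delta q -> face_span Delta (dvar v q).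
Proof.
move=> /face_spanP Hq; apply/face_spanP => m.
rewrite mcoeff_msupp mcoeff_mderiv => Hm.
have /Hq : (m + U_(enum_rank v))%MM \in msupp q.
  by rewrite mcoeff_msupp; apply: contraNneq Hm => ->; rewrite mul0rn.
apply: faces_down; apply/fintype.subsetP => w; rewrite !inE mnmDE.
by rewrite addn_eq0 negb_and => ->.
Qed.

Lemma lindiff_stress (R : realType) (V : finType) (d : nat)
    (Delta : simplicial_complex V) (p : V -> 'rV[R]_d) (a : V -> R)
    (q : {mpoly R[#|V|]}) :
  stress Delta p q -> stress Delta p (lindiff a q).
Proof.
move=> [Hq Ep]; split.
  apply/face_spanP => m; rewrite mcoeff_msupp raddf_sum /= => Hm.
  have [v Hv | H0] := pickP [pred v : V | m \in msupp (dvar v q)].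
    by have /face_spanP := dvar_face_span v Hq; apply.
  case/eqP: Hm; apply: big1 => v _; rewrite mcoeffZ.
  have /negbT := H0 v; rewrite /= mcoeff_msupp negbK => /eqP ->.
  by rewrite mulr0.
apply/rowP => j; rewrite summxE mxE.
have Ej : \sum_v (p v 0 j) *: dvar v q = 0.
  have := congr1 (fun M : 'rV_d => M 0 j) Ep; rewrite summxE mxE => {2}<-.
  by apply: eq_bigr => v _; rewrite !mxE mulrC mul_mpolyC.
transitivity (lindiff a (\sum_v (p v 0 j) *: dvar v q)); last first.
  by rewrite Ej /lindiff big1 // => v _; rewrite /dvar mderiv0 scaler0.
rewrite /lindiff.
transitivity (\sum_v \sum_w p v 0 j *: (a w *: dvar v (dvar w q))).
  apply: eq_bigr => v _; rewrite !mxE mulrC mul_mpolyC /dvar (raddf_sum (mderiv _)) /=.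
  by rewrite scaler_sumr; apply: eq_bigr => w _; rewrite mderivZ.
rewrite exchange_big /=; apply: eq_bigr => w _.
rewrite /dvar (raddf_sum (mderiv _)) /= scaler_sumr; apply: eq_bigr => v _.
by rewrite mderivZ mderiv_comm !scalerA mulrC.
Qed.

Lemma lindiff_stress_deg (R : realType) (V : finType) (d : nat)
    (Delta : simplicial_complex V) (p : V -> 'rV[R]_d) (a : V -> R) (k : int)
    (q : {mpoly R[#|V|]}) :
  stress_deg Delta p (k + 1) q -> stress_deg Delta p k (lindiff a q).
Proof.
have dhom n v : q \is n.+1.-homog -> dvar v q \is n.-homog.
  move/dhomogP=> Hq; apply/dhomogP => m; rewrite mcoeff_msupp mcoeff_mderiv.
  move=> Hm; have /Hq /= : (m + U_(enum_rank v))%MM \in msupp q.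
    by rewrite mcoeff_msupp; apply: contraNneq Hm => ->; rewrite mul0rn.
  by rewrite mdegD mdeg1 addn1 => -[].
have l0 : lindiff a 0 = 0 :> {mpoly R[#|V|]}.
  by rewrite /lindiff big1 // => v _; rewrite /dvar mderiv0 scaler0.
case: k => [n | n].
  rewrite -[n%:Z + 1]/(n + 1)%N%:Z addn1 /= => -[Hs Hh]; split.
    exact: lindiff_stress.
  by rewrite /lindiff rpred_sum // => v _; rewrite rpredZ // dhom.
case: n => [|n] /=; last by move=> ->.
move=> [_ /dhomogP Hh]; rewrite /lindiff; apply: big1 => v _.
suff -> : dvar v q = 0 by rewrite scaler0.
apply/mpolyP => m; rewrite mcoeff_mderiv mcoeff0.
have [/Hh /=|] := boolP ((m + U_(enum_rank v))%MM \in msupp q).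
  by rewrite mdegD mdeg1 addn1.
by rewrite mcoeff_msupp negbK => /eqP ->; rewrite mul0rn.
Qed.

(* Main.v *)
(** Since [omega] is injective on degree [k] stresses, the lifts [Q_v] of the
    derivatives [dq/dx_v] satisfy [dQ_v/dx_w = dQ_w/dx_v], so they are the
    partial derivatives of a single polynomial, which Euler's formula produces:
    [Q = (k+2)^-1 sum_v x_v Q_v].  Homogeneous polynomials of positive degree
    are determined by their derivatives, so [Q] inherits the stress equation and
    [omega Q = q].  The absence of missing faces of dimension [k+1] is only
    needed for the squarefree monomials of [Q]: every proper subset of such a
    support is a face. *)
Require Import Defs.
From HB Require Import structures.
From mathcomp Require Import all_boot all_order all_algebra.
From mathcomp Require Import classical_sets functions reals.
From mathcomp Require Import mpoly.

Import Order.TTheory GRing.Theory Num.Theory.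
Local Open Scope ring_scope.

Lemma lindiff_delta {R : realType} {V : finType} (w : V) (q : {mpoly R[#|V|]}) :
  lindiff (fun v => (v == w)%:R) q = dvar w q.
Proof.
rewrite /lindiff (bigD1 w) //= eqxx scale1r big1 ?addr0 // => v /negbTE ->.
by rewrite scale0r.
Qed.

Lemma dvar_lindiff {R : realType} {V : finType} (a : V -> R) (w : V)
    (q : {mpoly R[#|V|]}) :
  dvar w (lindiff a q) = lindiff a (dvar w q).
Proof.
rewrite /lindiff {1}/dvar raddf_sum /=; apply: eq_bigr => v _.
by rewrite mderivZ; congr (_ *: _); exact: mderiv_comm.
Qed.

Lemma dvarX {R : realType} {V : finType} (v w : V) :
  dvar v 'X_(enum_rank w) = (v == w)%:R :> {mpoly R[#|V|]}.
Proof.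
rewrite /dvar mderivX mnm1E (inj_eq enum_rank_inj) eq_sym.
case: eqVneq => [->|_]; last by rewrite scale0r.
by rewrite scale1r -[X in (X - _)%MM]add0m addmK mpolyX0.
Qed.

Lemma dvar_homog {R : realType} {V : finType} {n : nat} (v : V)
    {q : {mpoly R[#|V|]}} :
  q \is n.+1.-homog -> dvar v q \is n.-homog.
Proof.
move=> /dhomogP Hq; apply/dhomogP => m; rewrite mcoeff_msupp mcoeff_mderiv => Hm.
have /Hq /= : (m + U_(enum_rank v))%MM \in msupp q.
  by rewrite mcoeff_msupp; apply: contraNneq Hm => ->; rewrite mul0rn.
by rewrite mdegD mdeg1 addn1 => -[].
Qed.

Lemma lindiff_homog {R : realType} {V : finType} (a : V -> R) {n : nat}
    {q : {mpoly R[#|V|]}} :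
  q \is n.+1.-homog -> lindiff a q \is n.-homog.
Proof. by move=> Hq; rewrite rpred_sum // => v _; rewrite rpredZ // dvar_homog. Qed.

(** Euler's identity, checked on monomials: each [x_v] contributes its exponent, and the exponents
    add up to [n]. *)
Lemma euler_dvar {R : realType} {V : finType} {n : nat} {q : {mpoly R[#|V|]}} :
  q \is n.-homog -> \sum_v 'X_(enum_rank v) * dvar v q = q *+ n.
Proof.
move=> /dhomogP Hq; rewrite (mpolyE q) /dvar.
under eq_bigr => v _ do rewrite raddf_sum /= mulr_sumr.
rewrite exchange_big /= -sumrMnl big_seq [RHS]big_seq.
apply: eq_bigr => m /Hq /= <-.
rewrite mdegE (reindex _ (onW_bij _ (@enum_rank_bij V))) /= -sumrMnr.
apply: eq_bigr => v _; rewrite mderivZ mderivX scalerA -scalerAr.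
rewrite -mpolyXD -scaler_nat scalerA [_ * q@_m]mulrC.
(* Subtraction of exponents is truncated, so multiplying back by [x_v] restores [m] only if [x_v]
   occurs in it; otherwise both sides vanish. *)
have [->|m_v] := eqVneq (m (enum_rank v)) 0%N; first by rewrite mulr0 !scale0r.
by rewrite addmC submK // lep1mP.
Qed.

(** Euler's identity recovers [(n+1) q] from the derivatives of [q], and [n+1] is invertible in
    [R]. *)
Lemma dvar_inj {R : realType} {V : finType} {n : nat} {q1 q2 : {mpoly R[#|V|]}} :
  q1 \is n.+1.-homog -> q2 \is n.+1.-homog ->
  (forall v, dvar v q1 = dvar v q2) -> q1 = q2.
Proof.
move=> /euler_dvar E1 /euler_dvar E2 E12.
have : n.+1%:R *: q1 = n.+1%:R *: q2.
  by rewrite !scaler_nat -E1 -E2; apply: eq_bigr => v _; rewrite E12.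
by apply: scalerI; rewrite pnatr_eq0.
Qed.

(** A polynomial Poincaré lemma: closed homogeneous 1-forms are exact. *)
Lemma dvar_potential {R : realType} {V : finType} {n : nat}
    {Q : V -> {mpoly R[#|V|]}} :
  (forall v, Q v \is n.-homog) ->
  (forall v w, dvar w (Q v) = dvar v (Q w)) ->
  exists2 P, P \is n.+1.-homog & forall v, dvar v P = Q v.
Proof.
move=> HQ Qcomm; exists (n.+1%:R^-1 *: \sum_v 'X_(enum_rank v) * Q v).
  rewrite rpredZ // rpred_sum // => v _; rewrite -add1n.
  by apply: dhomogM => //; rewrite dhomogX /= mdeg1.
move=> w; rewrite /dvar mderivZ (raddf_sum (mderiv _)) /=.
(* By symmetry [dvar w (Q v)] becomes [dvar v (Q w)], so Euler's identity yields [n] copies of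
   [Q w]; differentiating the factor [x_w] yields one more. *)
have -> : \sum_v ('X_(enum_rank v) * Q v)^`M(enum_rank w) = Q w *+ n.+1.
  rewrite mulrS -(euler_dvar (HQ w)).
  under eq_bigr => v _ do
    rewrite mderivM -[_^`M(_)]/(dvar w _) -[(Q v)^`M(_)]/(dvar w _) dvarX Qcomm.
  rewrite big_split /=; congr (_ + _).
  rewrite (bigD1 w) //= eqxx mul1r big1 ?addr0 // => v.
  by rewrite eq_sym => /negbTE ->; rewrite mul0r.
by rewrite -scaler_nat scalerA mulVf ?scale1r // pnatr_eq0.
Qed.

(** Read coordinatewise, the stress equation is annihilation by [d] linear differentials, which
    commute with every [dvar v]. *)
Lemma stressP {R : realType} {V : finType} {d : nat}
    {Delta : simplicial_complex V} {p : V -> 'rV[R]_d} {q : {mpoly R[#|V|]}} :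
  stress Delta p q <->
  face_span Delta q /\ forall j, lindiff (fun v => p v 0 j) q = 0.
Proof.
have E j : (\sum_v dvar v q *: map_mx (@mpolyC #|V| R) (p v)) 0 j =
    lindiff (fun v => p v 0 j) q.
  by rewrite summxE; apply: eq_bigr => v _; rewrite !mxE mulrC mul_mpolyC.
split=> -[Hq Hp]; split=> //; first by move=> j; rewrite -E Hp mxE.
by apply/rowP => j; rewrite E Hp mxE.
Qed.

Lemma dvar_stress_deg {R : realType} {V : finType} {d : nat}
    {Delta : simplicial_complex V} {p : V -> 'rV[R]_d} {n : nat} (v : V)
    {q : {mpoly R[#|V|]}} :
  stress_deg Delta p n.+1%:Z q -> stress_deg Delta p n%:Z (dvar v q).
Proof.
move=> [Hq hq]; split; last exact: dvar_homog.
by rewrite -lindiff_delta; exact: lindiff_stress.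
Qed.

(** If a monomial of [q] has a non-face as support, lowering any of its exponents by one gives a
    face. Hence it is squarefree and its support is a missing face with [n] vertices. *)
Lemma face_span_of_dvar {R : realType} {V : finType}
    {Delta : simplicial_complex V} {n : nat} {q : {mpoly R[#|V|]}} :
  (forall s, missing_face Delta s -> #|s| <> n) ->
  q \is n.-homog -> (forall v, face_span Delta (dvar v q)) -> face_span Delta q.
Proof.
move=> no_missing /dhomogP hq Hq; apply/face_spanP => m qm.
apply: contraT => Hm.
have face_sub v : v \in mnm_support m ->
    mnm_support (m - U_(enum_rank v))%MM \in faces Delta.
  rewrite inE => m_v; have /face_spanP := Hq v; apply.
  (* Differentiation multiplies the coefficient of [m] by a positive exponent, so it stays nonzero
     in characteristic 0. *)
  rewrite mcoeff_msupp mcoeff_mderiv submK ?lep1mP //.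
  by rewrite -mulr_natr mulf_neq0 ?pnatr_eq0 // -mcoeff_msupp.
have supp_sub v w : w != v ->
    (w \in mnm_support (m - U_(enum_rank v))%MM) = (w \in mnm_support m).
  move=> wv; rewrite !inE mnmBE mnm1E (inj_eq enum_rank_inj).
  by rewrite [v == w]eq_sym (negbTE wv) subn0.
(* Lowering an exponent that is at least 2 would leave the support unchanged, making it a face. *)
have m1 v : v \in mnm_support m -> m (enum_rank v) = 1%N.
  move=> vm; apply/eqP; apply: contraNT Hm => m_v.
  have <- : mnm_support (m - U_(enum_rank v))%MM = mnm_support m.
    apply/setP => w; have [->|/supp_sub//] := eqVneq w v.
    rewrite vm inE mnmBE mnm1E eqxx; move: vm m_v; rewrite inE.
    by case: (m _) => [|[|]].
  exact: face_sub.
case: (no_missing (mnm_support m)).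
  apply/minsetP; split=> // B HB Bm; apply/eqP; rewrite finset.eqEsubset Bm /=.
  apply: contraR HB => /fintype.subsetPn[v vm vB].
  apply: faces_down (face_sub v vm); apply/fintype.subsetP => w wB.
  rewrite supp_sub ?(fintype.subsetP Bm) //.
  by apply: contraNneq vB => <-.
rewrite -(hq m qm) /= mdegE (reindex _ (onW_bij _ (@enum_rank_bij V))) /=.
rewrite -sum1_card big_mkcond /=; apply: eq_bigr => v _.
case: ifPn => [/m1 -> //|]; by rewrite inE negbK => /eqP.
Qed.

Theorem theorem4p5 (R : realType) (V : finType) (d : nat)
    (Delta : simplicial_complex V) (p : V -> 'rV[R]_d) (a : V -> R) (k : nat) :
  proper_complex Delta p ->
  toric_chordal Delta p a k%:Z ->
  (forall s : {set V}, missing_face Delta s -> simplex_dim s <> k%:Z + 1) ->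
  toric_chordal Delta p a (k%:Z + 1).
Proof.
move=> _ [surj_a inj_a] no_missing; rewrite /toric_chordal.
have kS (n : nat) : n%:Z + 1 = n.+1%:Z by rewrite intS addrC.
rewrite !kS in surj_a no_missing *.
split; last first.
  move=> q1 q2 /set_mem S1 /set_mem S2 E.
  apply: (dvar_inj S1.2 S2.2) => v.
  apply: inj_a; [exact/mem_set/dvar_stress_deg..|].
  by rewrite -!dvar_lindiff E.
move=> q Sq.
have /fin_all_exists[Q HQ] v : exists Qv,
    stress_deg Delta p k.+1%:Z Qv /\ lindiff a Qv = dvar v q.
  by have [Qv SQv EQv] := surj_a _ (dvar_stress_deg v Sq); exists Qv.
have Qcomm v w : dvar w (Q v) = dvar v (Q w).
  (* Both sides are stresses of degree [k], and [lindiff a] sends them to the same mixed second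
     derivative of [q]. *)
  apply: inj_a; [exact/mem_set/dvar_stress_deg/(HQ _).1..|].
  by rewrite -!dvar_lindiff !(HQ _).2; exact: mderiv_comm.
have [P hP EP] := dvar_potential (fun v => (HQ v).1.2) Qcomm.
exists P; last first.
  apply: (dvar_inj (lindiff_homog _ hP) Sq.2) => v.
  by rewrite dvar_lindiff EP (HQ v).2.
split=> //; apply/stressP; split=> [|j].
  (* [P] has degree [k+2], the number of vertices of a missing face of dimension [k+1]. *)
  apply: (face_span_of_dvar _ hP) => [s /no_missing|v]; last first.
    by rewrite EP; have [[]] := (HQ v).1.
  by move=> Hs sk; apply: Hs; rewrite /simplex_dim sk -kS addrK.
apply: (dvar_inj (lindiff_homog _ hP) (rpred0 _)) => v.
rewrite dvar_lindiff EP /dvar mderiv0.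
by have [/stressP[_ ->]] := (HQ v).1.
Qed.
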